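(* The operator $\triangle$ is $\mathcal{QM}$-invariant, i.e. $$\triangle(f\circ\psi)(\mathbf{a})=(\triangle f)(\psi(\mathbf{a}))$$ for any $\mathcal{QM}$-transformation $\psi$, any $f\in C^2(B^{4n})$ and any $\mathbf{a}\in B^{4n}$.
   Context: $\mathbb{H}$ is the quaternion algebra, $n\ge1$, $\mathbb{H}^n\cong\mathbb{R}^{4n}$ is the space of quaternionic $(n\times1)$ column vectors, $\mathbf{a}^*=\bar{\mathbf{a}}^t$, $|\mathbf{q}|^2=\mathbf{q}^*\mathbf{q}$, $B^{4n}=\{|\mathbf{q}|<1\}$. For $\mathbf{a}\in B^{4n}$ put $s_{\mathbf{a}}=(1-|\mathbf{a}|^2)^{1/2}$, $\mathbf{A}=(1-s_{\mathbf{a}})|\mathbf{a}|^{-2}\mathbf{a}\mathbf{a}^*+s_{\mathbf{a}}I_n$ (with $\mathbf{A}=I_n$ if $\mathbf{a}=\mathbf{0}$), and $\varphi_{\mathbf{a}}(\mathbf{q})=(\mathbf{a}-\mathbf{A}\mathbf{q})(1-\mathbf{a}^*\mathbf{q})^{-1}$. The $\mathcal{QM}$-invariant Laplacian is $(\triangle f)(\mathbf{a})=\triangle_0(f\circ\varphi_{\mathbf{a}})(\mathbf{0})$ for $f\in C^2(B^{4n})$, where $\triangle_0$ is the Euclidean Laplacian on $\mathbb{R}^{4n}$. A $\mathcal{QM}$-transformation is a map of $B^{4n}$ of the form $(\mathbf{U},q_0)\circ\varphi_{\mathbf{a}}$ with $\mathbf{a}\in B^{4n}$, $\mathbf{U}\in{\rm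 Sp}(n)$ (quaternionic $n\times n$ matrices with $\mathbf{U}\mathbf{U}^*=I_n$), $q_0\in{\rm Sp}(1)$ (unit quaternions), where $(\mathbf{U},q_0)$ is the map $\mathbf{q}\mapsto\mathbf{U}\mathbf{q}q_0^*$. *)

(* Defs.v *)
From HB Require Import structures.
From mathcomp Require Import all_boot all_order all_algebra.
From mathcomp Require Import ring.
From mathcomp Require Import all_classical all_reals all_analysis.

Set Implicit Arguments.
Unset Strict Implicit.
Unset Printing Implicit Defensive.

Import Order.TTheory GRing.Theory Num.Theory.
Import numFieldNormedType.Exports.

Local Open Scope classical_set_scope.
Local Open Scope ring_scope.

(* Quat a b c d is a + b i + c j + d k. *)
Record quat (R : Type) := Quat { qre : R; qi : R; qj : R; qk : R }.

Section QuatRing.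
Variable R : realType.
Implicit Types x y z : quat R.

Definition quat_tuple x := (qre x, qi x, qj x, qk x).
Definition tuple_quat (t : R * R * R * R) :=
  let: (a, b, c, d) := t in Quat a b c d.

Lemma quat_tupleK : cancel quat_tuple tuple_quat.
Proof. by case. Qed.

HB.instance Definition _ := Choice.copy (quat R) (can_type quat_tupleK).

Definition addq x y :=
  Quat (qre x + qre y) (qi x + qi y) (qj x + qj y) (qk x + qk y).
Definition oppq x := Quat (- qre x) (- qi x) (- qj x) (- qk x).
Definition mulq x y := Quat
  (qre x * qre y - qi x * qi y - qj x * qj y - qk x * qk y)
  (qre x * qi y + qi x * qre y + qj x * qk y - qk x * qj y)
  (qre x * qj y - qi x * qk y + qj x * qre y + qk x * qi y)
  (qre x * qk y + qi x * qj y - qj x * qi y + qk x * qre y).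

Definition qreal (r : R) : quat R := Quat r 0 0 0.
Definition conjq x := Quat (qre x) (- qi x) (- qj x) (- qk x).
Definition sqnormq x := qre x ^+ 2 + qi x ^+ 2 + qj x ^+ 2 + qk x ^+ 2.
Definition invq x := mulq (qreal (sqnormq x)^-1) (conjq x).

Fact addqA : associative addq.
Proof. by move=> [????] [????] [????]; congr Quat => /=; rewrite addrA. Qed.
Fact addqC : commutative addq.
Proof. by move=> [????] [????]; congr Quat => /=; rewrite addrC. Qed.
Fact add0q : left_id (qreal 0) addq.
Proof. by move=> [????]; congr Quat => /=; rewrite add0r. Qed.
Fact addNq : left_inverse (qreal 0) oppq addq.
Proof. by move=> [????]; congr Quat => /=; rewrite addNr. Qed.

HB.instance Definition _ :=
  GRing.isZmodule.Build (quat R) addqA addqC add0q addNq.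

Fact mulqA : associative mulq.
Proof. by move=> [????] [????] [????]; congr Quat => /=; ring. Qed.
Fact mul1q : left_id (qreal 1) mulq.
Proof. by move=> [????]; rewrite /mulq /=; congr Quat; ring. Qed.
Fact mulq1 : right_id (qreal 1) mulq.
Proof. by move=> [????]; rewrite /mulq /=; congr Quat; ring. Qed.
Fact mulqDl : left_distributive mulq +%R.
Proof. by move=> [????] [????] [????]; congr Quat => /=; ring. Qed.
Fact mulqDr : right_distributive mulq +%R.
Proof. by move=> [????] [????] [????]; congr Quat => /=; ring. Qed.
Fact oneq_neq0 : qreal 1 != 0 :> quat R.
Proof. by apply/eqP => -[] /eqP; rewrite oner_eq0. Qed.

HB.instance Definition _ := GRing.Zmodule_isNzRing.Build (quat R)
  mulqA mul1q mulq1 mulqDl mulqDr oneq_neq0.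

Lemma sqnormq_eq0 x : (sqnormq x == 0) = (x == 0).
Proof.
apply/idP/eqP => [|->]; last by rewrite /sqnormq /= !expr0n /= !addr0.
case: x => a b c d; rewrite /sqnormq /= !paddr_eq0 ?addr_ge0 ?sqr_ge0 //.
rewrite !sqrf_eq0.
by move=> /andP[/andP[/andP[/eqP-> /eqP->] /eqP->] /eqP->].
Qed.

Fact mulVq : {in [pred x : quat R | x != 0], left_inverse 1 invq *%R}.
Proof.
move=> x; rewrite inE -sqnormq_eq0; case: x => a b c d /=.
by rewrite /sqnormq /= => n0; congr Quat; rewrite /= /sqnormq /=; field.
Qed.

Fact mulqV : {in [pred x : quat R | x != 0], right_inverse 1 invq *%R}.
Proof.
move=> x; rewrite inE -sqnormq_eq0; case: x => a b c d /=.
by rewrite /sqnormq /= => n0; congr Quat; rewrite /= /sqnormq /=; field.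
Qed.

Fact quat_unitP x y : y * x = 1 /\ x * y = 1 -> x != 0.
Proof.
move=> [yx _]; apply: contra_eq_neq yx => ->.
by rewrite mulr0 eq_sym oner_neq0.
Qed.

Fact invq_out : {in [predC [pred x : quat R | x != 0]], invq =1 id}.
Proof.
move=> x; rewrite !inE negbK => /eqP->.
by rewrite /invq /mulq /=; congr Quat; ring.
Qed.

HB.instance Definition _ := GRing.NzRing_hasMulInverse.Build (quat R)
  mulVq mulqV quat_unitP invq_out.

End QuatRing.

Section QuaternionicBall.
Variables (R : realType) (n : nat).
Local Notation H := (quat R).

Definition adjmx m p (M : 'M[H]_(m, p)) : 'M[H]_(p, m) :=
  (map_mx (@conjq R) M)^T.

(* The product q^* q is a real quaternion (see adjmx_mul_self below). *)
Definition sqnormv (q : 'cV[H]_n) : R := qre ((adjmx q *m q) 0 0).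

Lemma adjmx_mul_self (q : 'cV[H]_n) : adjmx q *m q = (qreal (sqnormv q))%:M.
Proof.
apply/matrixP => i j; rewrite !ord1 [RHS]mxE eqxx mulr1n /sqnormv.
rewrite !mxE /=.
apply: (big_ind (fun x : H => x = qreal (qre x))) => //.
  by move=> x y -> ->; congr Quat; rewrite /= addr0.
by move=> k _; rewrite !mxE; case: (q k 0) => ? ? ? ?; congr Quat => /=; ring.
Qed.

Definition qball : set 'cV[H]_n := [set q | sqnormv q < 1].

Definition s_ (a : 'cV[H]_n) : R := Num.sqrt (1 - sqnormv a).

Definition A_ (a : 'cV[H]_n) : 'M[H]_n :=
  if a == 0 then 1%:M
  else qreal ((1 - s_ a) / sqnormv a) *: (a *m adjmx a)
       + qreal (s_ a) *: 1%:M.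

(* The scalars act on column vectors on the right: v *m c%:M is v c. *)
Definition phi (a q : 'cV[H]_n) : 'cV[H]_n :=
  (a - A_ a *m q) *m ((1 - (adjmx a *m q) 0 0)^-1)%:M.

(* Only the values of psi on the ball matter. *)
Definition QM_transformation (psi : 'cV[H]_n -> 'cV[H]_n) : Prop :=
  exists (a : 'cV[H]_n) (U : 'M[H]_n) (q0 : H),
    [/\ qball a, U *m adjmx U = 1%:M, sqnormq q0 = 1 &
        forall q, qball q -> psi q = U *m phi a q *m (conjq q0)%:M].

(* The identification of R^(4n), realized as the n x 4 real matrices (a normed
   module in the library), with H^n. *)
Definition ofreal (x : 'M[R]_(n, 4)) : 'cV[H]_n :=
  \col_i Quat (x i 0) (x i 1) (x i 2) (x i 3).

Definition toreal (q : 'cV[H]_n) : 'M[R]_(n, 4) :=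
  \matrix_(i, j) [:: qre (q i 0); qi (q i 0); qj (q i 0); qk (q i 0)]`_j.

Lemma ofrealK : cancel ofreal toreal.
Proof.
move=> x; apply/matrixP => i [[|[|[|[|//]]]] lt_j4]; rewrite !mxE /=;
  by congr (x i _); apply/val_inj.
Qed.

Lemma torealK : cancel toreal ofreal.
Proof.
by move=> q; apply/matrixP => i j; rewrite ord1 !mxE /=; case: (q i 0).
Qed.

Definition partial (ij : 'I_n * 'I_4) (F : 'M[R]_(n, 4) -> R) :
  'M[R]_(n, 4) -> R := 'D_(delta_mx ij.1 ij.2) F.

Definition has_partial (ij : 'I_n * 'I_4) (F : 'M[R]_(n, 4) -> R)
  (x : 'M[R]_(n, 4)) : Prop := derivable F x (delta_mx ij.1 ij.2).

(* F has continuous partial derivatives of all orders <= 2 on U, which is meant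
   to be open. *)
Definition C2_on (U : set 'M[R]_(n, 4)) (F : 'M[R]_(n, 4) -> R) : Prop :=
  forall x, U x ->
  [/\ {for x, continuous F},
      forall e, has_partial e F x /\ {for x, continuous (partial e F)} &
      forall e e', has_partial e' (partial e F) x /\
        {for x, continuous (partial e' (partial e F))}].

(* Functions on the ball are represented by total functions on H^n, whose
   values outside the ball are irrelevant. *)
Definition C2_ball (f : 'cV[H]_n -> R) : Prop :=
  C2_on (ofreal @^-1` qball) (f \o ofreal).

Definition euclidean_laplacian (f : 'cV[H]_n -> R) (q : 'cV[H]_n) : R :=
  \sum_(e : 'I_n * 'I_4) partial e (partial e (f \o ofreal)) (toreal q).

Definition invariant_laplacian (f : 'cV[H]_n -> R) (a : 'cV[H]_n) : R :=
  euclidean_laplacian (f \o phi a) 0.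

End QuaternionicBall.

(* Main.v *)
(* In homogeneous coordinates [q : 1], phi_a is the action of the matrix
   M_a = [[-A, a], [-a^*, 1]], which satisfies M_a^* J M_a = s_a^2 J for
   J = diag(1, ..., 1, -1) and M_a^2 = s_a^2. Hence, with b = psi(a), the map
   T = phi_b o psi o phi_a fixes 0 and is the action of a matrix preserving J
   up to a positive factor; such a matrix is block diagonal, so T is the
   restriction of a real-linear isometry. As psi o phi_a = phi_b o T, the
   theorem reduces to the invariance of the Euclidean Laplacian of f o phi_b at
   0 under linear isometries. The chain rule for it only needs first-order
   differentiability of f and of its partial derivatives, which follows from
   their being C^1 by the mean value theorem. *)
From HB Require Import structures.
Require Import Defs.
From mathcomp Require Import all_boot all_order all_algebra.
From mathcomp Require Import ring.
From mathcomp Require Import all_classical all_reals all_analysis.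

Set Implicit Arguments.
Unset Strict Implicit.
Unset Printing Implicit Defensive.

Import Order.TTheory GRing.Theory Num.Theory.
Import numFieldNormedType.Exports.

Local Open Scope classical_set_scope.
Local Open Scope ring_scope.

(** * Quaternionic matrices *)

Section QuaternionMatrices.
Variable R : realType.
Local Notation H := (quat R).
Implicit Types (x y : H) (r t : R).

Lemma quatP x y : qre x = qre y -> qi x = qi y -> qj x = qj y -> qk x = qk y ->
  x = y.
Proof. by case: x y => [????] [????] /= -> -> -> ->. Qed.

Lemma qrealD r t : qreal (r + t) = qreal r + qreal t.
Proof. by apply: quatP; rewrite /= ?addr0. Qed.

Lemma qrealN r : qreal (- r) = - qreal r.
Proof. by apply: quatP; rewrite /= ?oppr0. Qed.

Lemma qrealM r t : qreal (r * t) = qreal r * qreal t.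
Proof. by apply: quatP => /=; ring. Qed.

Lemma qreal_comm r x : qreal r * x = x * qreal r.
Proof. by apply: quatP => /=; ring. Qed.

Lemma qreal_inj : injective (@qreal R).
Proof. by move=> r t []. Qed.

Lemma conjqD x y : conjq (x + y) = conjq x + conjq y.
Proof. by apply: quatP => //=; ring. Qed.

Lemma conjq0 : conjq (0 : H) = 0.
Proof. by apply: quatP => //=; ring. Qed.

Lemma conjqM x y : conjq (x * y) = conjq y * conjq x.
Proof. by apply: quatP => /=; ring. Qed.

Lemma conjqN x : conjq (- x) = - conjq x.
Proof. by apply: quatP. Qed.

Lemma conjqK : involutive (@conjq R).
Proof. by move=> x; apply: quatP => //=; ring. Qed.

Lemma conjq_real r : conjq (qreal r) = qreal r.
Proof. by apply: quatP => //=; ring. Qed.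

Lemma conjq_mul_self x : conjq x * x = qreal (sqnormq x).
Proof. by rewrite /sqnormq; apply: quatP => /=; ring. Qed.

Lemma sqnormqM x y : sqnormq (x * y) = sqnormq x * sqnormq y.
Proof. by rewrite /sqnormq /=; ring. Qed.

Lemma sqnormq_ge0 x : 0 <= sqnormq x.
Proof. by rewrite /sqnormq !addr_ge0 ?sqr_ge0. Qed.

Lemma adjmxM m n p (M : 'M[H]_(m, n)) (N : 'M[H]_(n, p)) :
  adjmx (M *m N) = adjmx N *m adjmx M.
Proof.
apply/matrixP => i j; rewrite !mxE.
rewrite (big_morph (@conjq R) conjqD conjq0).
by apply: eq_bigr => k _; rewrite conjqM !mxE.
Qed.

Lemma adjmxD m n (M N : 'M[H]_(m, n)) : adjmx (M + N) = adjmx M + adjmx N.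
Proof. by apply/matrixP => i j; rewrite !mxE conjqD. Qed.

Lemma adjmxN m n (M : 'M[H]_(m, n)) : adjmx (- M) = - adjmx M.
Proof. by apply/matrixP => i j; rewrite !mxE conjqN. Qed.

Lemma adjmxK m n (M : 'M[H]_(m, n)) : adjmx (adjmx M) = M.
Proof. by apply/matrixP => i j; rewrite !mxE conjqK. Qed.

Lemma adjmx0 m n : adjmx (0 : 'M[H]_(m, n)) = 0.
Proof. by apply/matrixP => i j; rewrite !mxE conjq0. Qed.

Lemma adjmx_scalar n x : adjmx (x%:M : 'M[H]_n) = (conjq x)%:M.
Proof.
by apply/matrixP => i j; rewrite !mxE eq_sym; case: eqP => _; rewrite ?conjq0.
Qed.

Lemma adjmx1 n : adjmx (1%:M : 'M[H]_n) = 1%:M.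
Proof. by rewrite adjmx_scalar conjq_real. Qed.

Lemma adjmxZ m n r (M : 'M[H]_(m, n)) :
  adjmx (qreal r *: M) = qreal r *: adjmx M.
Proof.
by apply/matrixP => i j; rewrite !mxE conjqM conjq_real qreal_comm.
Qed.

Lemma adjmx_block m1 m2 n1 n2 (M11 : 'M[H]_(m1, n1)) (M12 : 'M[H]_(m1, n2))
    (M21 : 'M[H]_(m2, n1)) (M22 : 'M[H]_(m2, n2)) :
  adjmx (block_mx M11 M12 M21 M22) =
  block_mx (adjmx M11) (adjmx M21) (adjmx M12) (adjmx M22).
Proof. by rewrite /adjmx map_block_mx tr_block_mx. Qed.

Lemma adjmx_col m1 m2 n (Mu : 'M[H]_(m1, n)) (Md : 'M[H]_(m2, n)) :
  adjmx (col_mx Mu Md) = row_mx (adjmx Mu) (adjmx Md).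
Proof. by rewrite /adjmx map_col_mx tr_col_mx. Qed.

Lemma mulmx_qrealZr m n p r (M : 'M[H]_(m, n)) (N : 'M[H]_(n, p)) :
  M *m (qreal r *: N) = qreal r *: (M *m N).
Proof.
apply/matrixP => i j; rewrite !mxE mulr_sumr; apply: eq_bigr => k _.
by rewrite !mxE mulrA -qreal_comm mulrA.
Qed.

Lemma mulmx_qreal_scalar m n r (M : 'M[H]_(m, n)) :
  M *m (qreal r)%:M = qreal r *: M.
Proof. by rewrite -scalemx1 mulmx_qrealZr mulmx1. Qed.

End QuaternionMatrices.

(** * Action on homogeneous coordinates *)

Section ProjectiveAction.
Variables (R : realType) (n : nat).
Local Notation H := (quat R).
Implicit Types (a b q : 'cV[H]_n) (M N : 'M[H]_(n + 1)) (k : R).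

(** Gram matrix of the Hermitian form |q|^2 - |c|^2, which is negative at [hom q] exactly when q is
    in the ball. *)
Definition lorentz_mx : 'M[H]_(n + 1) := block_mx 1%:M 0 0 (- 1%:M).

(** The free factor k spares normalizing the matrices of the [phi a] by [s_ a]. *)
Definition similitude k M :=
  adjmx M *m lorentz_mx *m M = qreal k *: lorentz_mx.

Definition hom q : 'cV[H]_(n + 1) := col_mx q 1%:M.

(** Equality of points of projective space: the scalar acts on the right, so it commutes with left
    multiplication by matrices. *)
Definition hom_image M q q' :=
  exists2 c : H, c != 0 & M *m hom q = hom q' *m c%:M.

Lemma similitudeM k l M N :
  similitude k M -> similitude l N -> similitude (k * l) (M *m N).
Proof.
rewrite /similitude => MJ NJ; rewrite adjmxM -!mulmxA (mulmxA lorentz_mx).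
rewrite (mulmxA (adjmx M)) (mulmxA (adjmx M)) MJ -scalemxAl mulmx_qrealZr.
by rewrite mulmxA NJ scalerA -qrealM.
Qed.

Lemma hom_imageM M N q1 q2 q3 :
  hom_image M q2 q3 -> hom_image N q1 q2 -> hom_image (M *m N) q1 q3.
Proof.
move=> [c c0 Mq] [d d0 Nq]; exists (c * d).
  by rewrite -sqnormq_eq0 sqnormqM mulf_neq0 // sqnormq_eq0.
by rewrite -mulmxA Nq mulmxA Mq -mulmxA -scalar_mxM.
Qed.

Lemma hom_mul_inj q1 q2 (c d : H) :
  d != 0 -> hom q1 *m c%:M = hom q2 *m d%:M -> q1 = q2.
Proof.
move=> d0; rewrite !mul_col_mx !mul1mx => /eq_col_mx [q12 /matrixP/(_ 0 0)].
rewrite !mxE !eqxx !mulr1n => cd; move: q12; rewrite cd.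
move=> /(congr1 (mulmx^~ (d^-1)%:M)).
by rewrite -!mulmxA -!scalar_mxM mulrV // !mulmx1.
Qed.

Lemma lorentz_form_col q (c : H) :
  adjmx (col_mx q c%:M) *m lorentz_mx *m col_mx q c%:M =
  (qreal (sqnormv q - sqnormq c))%:M.
Proof.
rewrite adjmx_col mul_row_block !mulmx0 addr0 add0r mulmx1 mul_row_col.
rewrite adjmx_mul_self adjmx_scalar mulmxN mulmx1 mulNmx -scalar_mxM.
by rewrite conjq_mul_self qrealD qrealN [RHS]raddfB.
Qed.

Lemma sqnormv_mulr q (c : H) : sqnormv (q *m c%:M) = sqnormv q * sqnormq c.
Proof.
rewrite [LHS]/sqnormv adjmxM -mulmxA (mulmxA (adjmx q)) adjmx_mul_self.
rewrite adjmx_scalar -!scalar_mxM mxE eqxx mulr1n qreal_comm mulrA.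
by rewrite conjq_mul_self -qrealM /= mulrC.
Qed.

Lemma sqnormvE q : sqnormv q = \sum_i sqnormq (q i 0).
Proof.
rewrite /sqnormv mxE (big_morph (@qre R) (id1 := 0) (op1 := +%R)) //.
by apply: eq_bigr => i _; rewrite !mxE conjq_mul_self.
Qed.

Lemma sqnormv_ge0 q : 0 <= sqnormv q.
Proof. by rewrite sqnormvE sumr_ge0 // => i _; apply: sqnormq_ge0. Qed.

(** Evaluates the defining identity of [similitude] at [hom q], where the form is |q|^2 - 1. *)
Lemma similitude_form k M q v (d : H) :
  similitude k M -> M *m hom q = col_mx v d%:M ->
  sqnormv v - sqnormq d = k * (sqnormv q - 1).
Proof.
move=> MJ Mq; suff: (qreal (sqnormv v - sqnormq d))%:M =
    (qreal (k * (sqnormv q - 1)))%:M :> 'M[H]_1.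
  by move=> /matrixP/(_ 0 0); rewrite !mxE eqxx !mulr1n => /qreal_inj.
rewrite -lorentz_form_col -Mq adjmxM -!mulmxA (mulmxA lorentz_mx).
rewrite (mulmxA (adjmx M)) (mulmxA (adjmx M)) MJ -scalemxAl mulmx_qrealZr.
rewrite mulmxA lorentz_form_col qrealM -mul_scalar_mx -scalar_mxM.
by rewrite /sqnormq /= expr0n !addr0 expr1n.
Qed.

(* For [q] in the ball the form is negative at [M *m hom q], so the last
   homogeneous coordinate dominates the others. *)
Lemma similitude_ball k M q v (d : H) :
  0 < k -> similitude k M -> qball q -> M *m hom q = col_mx v d%:M ->
  [/\ d != 0, qball (v *m d^-1%:M) & hom_image M q (v *m d^-1%:M)].
Proof.
move=> k0 MJ; rewrite /qball /= => q1 Mq; have := similitude_form MJ Mq.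
have : k * (sqnormv q - 1) < 0 by rewrite pmulr_rlt0 // subr_lt0.
move=> /[swap] <-; rewrite subr_lt0 => vd.
have d0 : d != 0.
  rewrite -sqnormq_eq0 gt_eqF //; exact: le_lt_trans (sqnormv_ge0 v) vd.
split=> //.
  rewrite sqnormv_mulr -(ltr_pM2r (le_lt_trans (sqnormv_ge0 v) vd)) mul1r.
  by rewrite -mulrA -sqnormqM mulVr // /sqnormq /= expr0n !addr0 expr1n mulr1.
exists d => //; rewrite Mq /hom mul_col_mx mul1mx -mulmxA -scalar_mxM.
by rewrite mulVr // mulmx1.
Qed.

End ProjectiveAction.

(** * The involutions [phi a] as similitudes *)

Section Involution.
Variables (R : realType) (n : nat).
Local Notation H := (quat R).
Implicit Types (a q : 'cV[H]_n).

(* The formula covers [a = 0], where division by zero gives coefficient 0. *)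
Lemma A_E a : A_ a = qreal ((1 - s_ a) / sqnormv a) *: (a *m adjmx a)
  + qreal (s_ a) *: 1%:M.
Proof.
rewrite /A_; case: eqP => // ->; rewrite mul0mx scaler0 add0r /s_.
have -> : sqnormv (0 : 'cV[H]_n) = 0 by rewrite /sqnormv mulmx0 mxE.
by rewrite subr0 sqrtr1 scale1r.
Qed.

Lemma sqnormv_eq0 a : sqnormv a = 0 -> a = 0.
Proof.
rewrite sqnormvE => /eqP; rewrite psumr_eq0 => [/allP a0|i _]; last first.
  exact: sqnormq_ge0.
apply/matrixP => i j; rewrite ord1 mxE; apply/eqP; rewrite -sqnormq_eq0.
by apply: a0; rewrite mem_index_enum.
Qed.

Lemma s_sqr a : qball a -> s_ a ^+ 2 = 1 - sqnormv a.
Proof. by move=> a1; rewrite sqr_sqrtr // subr_ge0 ltW. Qed.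

Lemma s_sqr_gt0 a : qball a -> 0 < s_ a ^+ 2.
Proof. by move=> a1; rewrite s_sqr // subr_gt0. Qed.

Lemma adjmx_A a : adjmx (A_ a) = A_ a.
Proof. by rewrite A_E adjmxD !adjmxZ adjmxM adjmxK adjmx1. Qed.

Lemma mul_outer_self a : a *m adjmx a *m a = qreal (sqnormv a) *: a.
Proof. by rewrite -mulmxA adjmx_mul_self mulmx_qreal_scalar. Qed.

(** The vector a is an eigenvector of a a^* with eigenvalue |a|^2, so the two coefficients add up to
    (1 - s_a) + s_a = 1. *)
Lemma A_mul_self a : A_ a *m a = a.
Proof.
rewrite A_E mulmxDl -!scalemxAl mul1mx mul_outer_self scalerA -scalerDl.
rewrite -qrealM -qrealD.
have [/sqnormv_eq0 ->|a0] := eqVneq (sqnormv a) 0; first by rewrite scaler0.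
by rewrite divfK // subrK scale1r.
Qed.

Lemma adj_mul_A a : adjmx a *m A_ a = adjmx a.
Proof. by rewrite -[LHS]adjmxK adjmxM adjmxK adjmx_A A_mul_self. Qed.

(** The coefficient of a a^* in the square is (1 - s_a)(1 + s_a) / |a|^2, which is 1 because s_a^2 =
    1 - |a|^2. *)
Lemma A_sqr a : qball a ->
  A_ a *m A_ a = a *m adjmx a + qreal (s_ a ^+ 2) *: 1%:M.
Proof.
move=> a1; rewrite {2}A_E mulmxDr !mulmx_qrealZr mulmxA A_mul_self mulmx1.
rewrite {1}A_E scalerDr !scalerA addrA -scalerDl -!qrealM -qrealD expr2.
congr (_ + _).
have [/sqnormv_eq0 ->|a0] := eqVneq (sqnormv a) 0.
  by rewrite mul0mx scaler0.
rewrite [X in qreal X](_ : _ = 1) ?scale1r //.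
have -> : (1 - s_ a) / sqnormv a + s_ a * ((1 - s_ a) / sqnormv a) =
  (1 - s_ a ^+ 2) / sqnormv a by field.
by rewrite s_sqr // subKr divff.
Qed.

Definition phi_mx a : 'M[H]_(n + 1) :=
  block_mx (- A_ a) a (- adjmx a) 1%:M.

(** Off-diagonal blocks cancel because [A_ a] fixes a; the diagonal ones come from [A_sqr] and from
    a^* a = 1 - s_a^2. *)
Lemma phi_mx_similitude a : qball a -> similitude (s_ a ^+ 2) (phi_mx a).
Proof.
move=> a1; rewrite /similitude /phi_mx /lorentz_mx adjmx_block !adjmxN adjmxK.
rewrite adjmx_A adjmx1 !mulmx_block.
rewrite !(mulmxN, mulNmx, mulmx0, mulmx1, mul1mx, oppr0, addr0, add0r, opprK).
rewrite A_mul_self adj_mul_A !(subrr, addNr) A_sqr // addrC addKr.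
rewrite scale_block_mx !scaler0 scalerN s_sqr // adjmx_mul_self.
congr block_mx.
by rewrite qrealD qrealN scalerBl scale1r opprB -mulmx_qreal_scalar mul1mx.
Qed.

Lemma phi_mx_sqr a : qball a ->
  phi_mx a *m phi_mx a = qreal (s_ a ^+ 2) *: 1%:M.
Proof.
move=> a1; rewrite /phi_mx mulmx_block.
rewrite !(mulmxN, mulNmx, mulmx0, mulmx1, mul1mx, oppr0, addr0, add0r, opprK).
rewrite A_mul_self adj_mul_A !(subrr, addNr) A_sqr // addrC addKr.
rewrite scalar_mx_block scale_block_mx !scaler0 s_sqr // adjmx_mul_self.
congr block_mx.
by rewrite qrealD qrealN scalerBl scale1r addrC -mulmx_qreal_scalar mul1mx.
Qed.

Lemma phi_mx_hom a q : phi_mx a *m hom q =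
  col_mx (a - A_ a *m q) (1 - (adjmx a *m q) 0 0)%:M.
Proof.
rewrite mul_block_col !mulmx1 mulNmx addrC mulNmx addrC.
rewrite {1}[adjmx a *m q]mx11_scalar; congr col_mx.
by rewrite addrC [RHS]raddfB.
Qed.

Lemma phi_ball a q : qball a -> qball q ->
  qball (phi a q) /\ hom_image (phi_mx a) q (phi a q).
Proof.
move=> a1 q1.
by have [] := similitude_ball (s_sqr_gt0 a1) (phi_mx_similitude a1) q1
  (phi_mx_hom a q).
Qed.

Lemma qball0 : qball (0 : 'cV[H]_n).
Proof. by rewrite /qball /= /sqnormv mulmx0 mxE. Qed.

Lemma phi_0 a : phi a 0 = a.
Proof. by rewrite /phi !mulmx0 mxE !subr0 invr1 mulmx1. Qed.

Lemma phi_self a : phi a a = 0.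
Proof. by rewrite /phi A_mul_self subrr mul0mx. Qed.

(** The square of [phi_mx a] is a nonzero real scalar matrix, which acts trivially on projective
    points. *)
Lemma phiK a q : qball a -> qball q -> phi a (phi a q) = q.
Proof.
move=> a1 q1; have [pq1 iq] := phi_ball a1 q1.
have [_ ipq] := phi_ball a1 pq1.
have [c c0] := hom_imageM ipq iq.
rewrite phi_mx_sqr // -scalemxAl mul1mx -mulmx_qreal_scalar => /esym.
apply: hom_mul_inj; rewrite -sqnormq_eq0 /sqnormq /= expr0n !addr0.
by rewrite expf_neq0 // gt_eqF // s_sqr_gt0.
Qed.

End Involution.

(** * Real-linear maps and isometries of matrix spaces *)

Section RealLinearMaps.
Variable R : realType.

(** One-sided inverses of square real matrices are two-sided; [lin_mx] replaces the maps by their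
    matrices on vectorized arguments. *)
Lemma linear_cancel_sym m p (f g : {linear 'M[R]_(m, p) -> 'M[R]_(m, p)}) :
  cancel f g -> cancel g f.
Proof.
move=> fK; have lin_fg : lin_mx f *m lin_mx g = 1%:M.
  apply/row_matrixP => i; rewrite !rowE mulmxA mulmx1.
  by rewrite -[delta_mx _ _]vec_mxK !mul_vec_lin /= fK.
move=> x; apply: (can_inj mxvecK).
by rewrite -mul_vec_lin -mul_vec_lin -mulmxA (mulmx1C lin_fg) mulmx1.
Qed.

(** The hypothesis reads [M^T *m M = 1%:M] once I is enumerated, and a left inverse of a square real
    matrix is a right inverse. *)
Lemma orthonormal_rows (I : finType) (t : I -> I -> R) :
  (forall i j, \sum_k t k i * t k j = (i == j)%:R) ->
  forall i j, \sum_k t i k * t j k = (i == j)%:R.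
Proof.
move=> tt i j.
pose M : 'M[R]_#|I| := \matrix_(r, s) t (enum_val r) (enum_val s).
have MM : M^T *m M = 1%:M.
  apply/matrixP => r s; rewrite !mxE -(inj_eq enum_val_inj) -tt.
  rewrite (reindex _ (onW_bij _ (enum_val_bij I))) /=.
  by apply: eq_bigr => k _; rewrite !mxE.
have /matrixP/(_ (enum_rank i) (enum_rank j)) := mulmx1C MM.
rewrite !mxE (inj_eq enum_rank_inj) => <-.
rewrite (reindex _ (onW_bij _ (enum_val_bij I))) /=.
by apply: eq_bigr => k _; rewrite !mxE !enum_rankK.
Qed.

(** The Euclidean norm squared, as opposed to the sup norm of the normed module of matrices. *)
Definition sqnormm m p (x : 'M[R]_(m, p)) :=
  \sum_(e : 'I_m * 'I_p) x e.1 e.2 ^+ 2.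

(** By polarization L preserves inner products, so the images of the unit matrices are orthonormal;
    [orthonormal_rows] then transposes this. *)
Lemma isometry_rows m p (L : {linear 'M[R]_(m, p) -> 'M[R]_(m, p)}) :
  (forall x, sqnormm (L x) = sqnormm x) ->
  forall k l : 'I_m * 'I_p,
    \sum_(e : 'I_m * 'I_p)
      L (delta_mx e.1 e.2) k.1 k.2 * L (delta_mx e.1 e.2) l.1 l.2
    = (k == l)%:R.
Proof.
move=> isoL; apply: (orthonormal_rows
  (t := fun k e => L (delta_mx e.1 e.2) k.1 k.2)) => i j.
have polar (x y : 'M[R]_(m, p)) :
    (\sum_(k : 'I_m * 'I_p) x k.1 k.2 * y k.1 k.2) *+ 2 =
    sqnormm (x + y) - sqnormm x - sqnormm y.
  rewrite /sqnormm -sumrMnl -!sumrB; apply: eq_bigr => k _.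
  by rewrite mxE; ring.
apply: (@mulIf _ 2%:R); first by rewrite pnatr_eq0.
rewrite !mulr_natr polar -raddfD !isoL -polar; congr (_ *+ 2).
rewrite (bigD1 i) //= big1 ?addr0 => [|k]; rewrite !mxE.
  by rewrite !eqxx mul1r -xpair_eqE -!surjective_pairing.
by rewrite -xpair_eqE -!surjective_pairing => /negbTE ->; rewrite mul0r.
Qed.

End RealLinearMaps.

(** * Unitary maps and the normal form of similitudes fixing the origin *)

Section NormalForm.
Variables (R : realType) (n : nat).
Local Notation H := (quat R).
Implicit Types (a q : 'cV[H]_n) (U V : 'M[H]_n) (c : H).

Lemma ofreal_linear (r : R) (x y : 'M[R]_(n, 4)) :
  ofreal (r *: x + y) = qreal r *: ofreal x + ofreal y.
Proof. by apply/matrixP => i j; rewrite !mxE; apply: quatP => /=; ring. Qed.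

Lemma toreal_linear (r : R) (p q : 'cV[H]_n) :
  toreal (qreal r *: p + q) = r *: toreal p + toreal q.
Proof. by rewrite -[RHS]ofrealK ofreal_linear !torealK. Qed.

(** Two-sided multiplication by quaternions is in general linear only over the reals, hence the
    passage to real coordinates. *)
Definition real_mul U c (x : 'M[R]_(n, 4)) := toreal (U *m ofreal x *m c%:M).

Fact real_mul_linear U c : linear (real_mul U c).
Proof.
move=> r x y; rewrite /real_mul ofreal_linear mulmxDr mulmx_qrealZr mulmxDl.
by rewrite -scalemxAl toreal_linear.
Qed.

HB.instance Definition _ U c := GRing.isLinear.Build R 'M[R]_(n, 4)
  'M[R]_(n, 4) _ (real_mul U c) (real_mul_linear U c).

Lemma sqnormm_toreal q : sqnormm (toreal q) = sqnormv q.
Proof.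
rewrite sqnormvE /sqnormm -(pair_bigA _ (fun i j => toreal q i j ^+ 2)) /=.
apply: eq_bigr => i _; rewrite !big_ord_recl big_ord0 addr0 !mxE /=.
by rewrite /sqnormq !addrA.
Qed.

(** Left multiplications by U and by its adjoint are real-linear endomorphisms of a
    finite-dimensional space, so being inverse on one side suffices; unit columns recover the matrix
    identity. *)
Lemma adjmx_unitary U : U *m adjmx U = 1%:M -> adjmx U *m U = 1%:M.
Proof.
move=> UU; have fK : cancel (real_mul (adjmx U) 1) (real_mul U 1).
  move=> x; rewrite /real_mul !mulmx1 torealK mulmxA UU mul1mx.
  by rewrite ofrealK.
have gK := linear_cancel_sym fK.
apply/matrixP => i j; have := gK (toreal (delta_mx j 0)).
rewrite /= /real_mul !mulmx1 !torealK mulmxA => /(can_inj (@torealK R n)).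
by rewrite -colE => /matrixP/(_ i 0); rewrite !mxE eqxx andbT.
Qed.

Definition unitary_mx U c : 'M[H]_(n + 1) := block_mx U 0 0 c%:M.

Lemma unitary_mx_similitude U c : U *m adjmx U = 1%:M -> sqnormq c = 1 ->
  similitude 1 (unitary_mx U c).
Proof.
move=> /adjmx_unitary UU c1; rewrite /similitude adjmx_block !mulmx_block.
rewrite !adjmx0 adjmx_scalar.
rewrite !(mulmxN, mulNmx, mulmx0, mul0mx, mulmx1, mul1mx, oppr0, addr0, add0r).
by rewrite UU -scalar_mxM conjq_mul_self c1 scale1r.
Qed.

(** The point [U q : c] equals [U q c^-1 : 1], and [conjq c] is the inverse of the unit c. *)
Lemma unitary_hom U c q : sqnormq c = 1 ->
  hom_image (unitary_mx U c) q (U *m q *m (conjq c)%:M).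
Proof.
move=> c1; exists c; first by rewrite -sqnormq_eq0 c1 oner_neq0.
rewrite mul_block_col mul_col_mx !mul0mx addr0 add0r mulmx1 mul1mx -mulmxA.
by rewrite -scalar_mxM conjq_mul_self c1 mulmx1.
Qed.

Lemma unitary_ball U c q : U *m adjmx U = 1%:M -> sqnormq c = 1 ->
  qball q -> qball (U *m q *m (conjq c)%:M).
Proof.
move=> /adjmx_unitary UU c1; rewrite /qball /= sqnormv_mulr.
have -> : sqnormq (conjq c) = sqnormq c by rewrite /sqnormq /=; ring.
by rewrite c1 mulr1 /sqnormv adjmxM -mulmxA (mulmxA _ U) UU mul1mx.
Qed.

(* A similitude fixing the origin is block diagonal, hence acts linearly. *)
Lemma similitude_fix0 (k : R) (M : 'M[H]_(n + 1)) (q' : 'cV[H]_n -> 'cV[H]_n) :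
  0 < k -> similitude k M -> q' 0 = 0 ->
  (forall q, qball q -> hom_image M q (q' q)) ->
  exists V c, (forall q, sqnormv (V *m q *m c%:M) = sqnormv q) /\
    forall q, qball q -> q' q = V *m q *m c%:M.
Proof.
move=> k0; rewrite -[M]submxK.
move: (ulsubmx M) (ursubmx M) (dlsubmx M) (drsubmx M) => V v w p MJ q'0 imM.
(* The image of [0 : 1] is [v : p], which must again be the origin. *)
have v0 : v = 0.
  have [c _] := imM 0 (@qball0 R n); rewrite q'0 mul_block_col !mulmx0 !add0r.
  by rewrite mul_col_mx mul0mx !mulmx1 => /eq_col_mx [].
have p0 : p 0 0 != 0.
  have [c c0] := imM 0 (@qball0 R n); rewrite q'0 mul_block_col !mulmx0 !add0r.
  by rewrite mul_col_mx !mul1mx !mulmx1 => /eq_col_mx [_ ->]; rewrite mxE eqxx.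
move: MJ; rewrite /similitude adjmx_block !mulmx_block scale_block_mx.
rewrite v0 adjmx0.
rewrite !(mulmxN, mulNmx, mulmx0, mul0mx, mulmx1, mul1mx, oppr0, addr0, add0r).
rewrite !scaler0 => /eq_block_mx [VV /eqP + _ pp].
rewrite oppr_eq0 => /eqP wp.
move: pp; rewrite [p]mx11_scalar adjmx_scalar -scalar_mxM conjq_mul_self.
rewrite scalerN => /oppr_inj /matrixP/(_ 0 0).
rewrite !mxE eqxx mulr1n mulr1 => /qreal_inj pk.
(* The upper right block of the similitude identity gives w^* p = 0 with p invertible. *)
have w0 : w = 0.
  apply: (can_inj (@adjmxK R 1 n)); rewrite adjmx0.
  rewrite -[LHS]mulmx1 -(@mulrV _ (p 0 0) p0) scalar_mxM mulmxA.
  by rewrite -mx11_scalar wp mul0mx.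
(* The identity has become V^* V = k and |p|^2 = k, so the factor k cancels in the norm of V q
   p^-1. *)
exists V, (p 0 0)^-1; split=> [q|q q1].
  rewrite sqnormv_mulr /sqnormv adjmxM -mulmxA (mulmxA _ V).
  move: VV; rewrite w0 mulmx0 subr0 => ->.
  rewrite -scalemxAl mul1mx mulmx_qrealZr adjmx_mul_self mxE mxE eqxx mulr1n.
  rewrite -qrealM /= mulrAC -pk -sqnormqM mulrV // /sqnormq /= expr0n !addr0.
  by rewrite expr1n mul1r.
have [c c0] := imM q q1.
rewrite mul_block_col w0 v0 !mul0mx !mulmx1 add0r addr0.
rewrite [p]mx11_scalar mul_col_mx mul1mx => /eq_col_mx [-> /matrixP/(_ 0 0)].
rewrite !mxE eqxx !mulr1n => pc.
by rewrite -mulmxA pc -scalar_mxM mulrV // mulmx1.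
Qed.

Lemma QM_transformation_phi (psi : 'cV[H]_n -> 'cV[H]_n) a :
  QM_transformation psi -> qball a ->
  qball (psi a) /\
  exists V c, (forall q, sqnormv (V *m q *m c%:M) = sqnormv q) /\
    forall q, qball q -> psi (phi a q) = phi (psi a) (V *m q *m c%:M).
Proof.
move=> [b [U [q0 [b1 UU q01 psiE]]]] a1.
have psi1 q : qball q -> qball (psi q).
  move=> q1; rewrite psiE //; apply: unitary_ball => //.
  exact: (phi_ball b1 q1).1.
have pa1 := psi1 a a1; split=> //.
pose M := phi_mx (psi a) *m (unitary_mx U q0 *m (phi_mx b *m phi_mx a)).
have := @similitude_fix0 _ M (fun q => phi (psi a) (psi (phi a q))).
move=> /(_ (s_ (psi a) ^+ 2 * (1 * (s_ b ^+ 2 * s_ a ^+ 2)))).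
case=> [||/=|q q1|V [c [isoV psiV]]].
- rewrite mul1r.
  exact: mulr_gt0 (s_sqr_gt0 pa1) (mulr_gt0 (s_sqr_gt0 b1) (s_sqr_gt0 a1)).
- have unitU := unitary_mx_similitude UU q01.
  have simba := similitudeM (phi_mx_similitude b1) (phi_mx_similitude a1).
  exact: similitudeM (phi_mx_similitude pa1) (similitudeM unitU simba).
- by rewrite phi_0 phi_self.
- have [q2 iq1] := phi_ball a1 q1; have [q3 iq2] := phi_ball b1 q2.
  have [_ iq4] := phi_ball pa1 (psi1 _ q2).
  have iq3 : hom_image (unitary_mx U q0) (phi b (phi a q)) (psi (phi a q)).
    by rewrite (psiE _ q2); apply: unitary_hom.
  have iq23 := hom_imageM iq3 (hom_imageM iq2 iq1).
  exact: hom_imageM iq4 iq23.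
(* The normal form describes [phi (psi a) \o psi \o phi a]; the involution [phi (psi a)] moves to
   the other side. *)
exists V, c; split=> // q q1; rewrite -psiV // phiK //.
by apply: psi1; apply: (phi_ball a1 q1).1.
Qed.

End NormalForm.

(** * Differentiability from continuous partial derivatives *)

Section Differentiability.
Variable R : realType.

(** The bound is the first-order expansion in epsilon form; uniqueness identifies [df] with
    ['d f x]. *)
Lemma differentiable_of_littleo (V W : normedModType R) (f : V -> W)
    (df : {linear V -> W}) (x : V) : continuous df ->
  (forall eps, 0 < eps ->
    \forall h \near (0 : V), `|f (h + x) - f x - df h| <= eps * `|h|) ->
  differentiable f x.
Proof.
move=> cdf lo; have fE : f \o shift x = cst (f x) + df +o_ 0 id.
  apply/eqaddoP => eps eps0; near=> h.
  have -> : (f \o shift x - (cst (f x) + df)) h = f (h + x) - f x - df h.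
    by rewrite -[LHS]/(f (h + x) - (f x + df h)) opprD addrA.
  by near: h; apply: lo.
by apply/diff_locallyP; rewrite (diff_unique cdf fE); split.
Unshelve. all: by end_near. Qed.

Lemma near_eq_differentiable (V W : normedModType R) (f g : V -> W) (x : V) :
  (\near x, f x = g x) -> differentiable f x -> differentiable g x.
Proof.
move=> fg df; have [cdf /eqaddoP fE] := (diff_locallyP _ _).1 df.
apply: (differentiable_of_littleo cdf) => eps eps0; near=> h.
have /= <- : (f \o shift x - (cst (f x) + 'd f x)) h =
    g (h + x) - g x - 'd f x h.
  rewrite -[LHS]/(f (h + x) - (f x + 'd f x h)) opprD addrA (nbhs_singleton fg).
  congr (_ - _ - _); near: h.
  by move: fg; rewrite (near_shift 0) subr0.
by near: h; apply: fE.
Unshelve. all: by end_near. Qed.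

Lemma mvt_line (V : normedModType R) (F : V -> R) (y v : V) (a b : R) :
  a <= b -> (forall s, a <= s <= b -> derivable F (y + s *: v) v) ->
  exists2 s, a <= s <= b &
    F (y + b *: v) - F (y + a *: v) = 'D_v F (y + s *: v) * (b - a).
Proof.
move=> ab dF; pose G s := F (y + s *: v).
(* The difference quotients of G at s and of F along v coincide as functions of h, so derivability
   and derivatives transfer. *)
have GE s : (fun h : R => h^-1 *: ((G \o shift s) (h *: 1) - G s)) =
    (fun h : R => h^-1 *: ((F \o shift (y + s *: v)) (h *: v) -
      F (y + s *: v))).
  apply/funext => h; rewrite /G /= [h *: 1]mulr1 scalerDl.
  by rewrite addrCA.
have dG s : a <= s <= b -> derivable G s 1 by rewrite /derivable GE; apply: dF.
have [|//|s] := @MVT_segment R G (fun s => 'D_v F (y + s *: v)) a b ab.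
- move=> s /itvP s_ab; apply: DeriveDef; first by apply: dG; rewrite !s_ab.
  by rewrite /derive GE.
- apply: derivable_within_continuous => s /itvP s_ab.
  by apply: dG; rewrite !s_ab.
by move=> s_ab; exists s.
Qed.

(** Treats both signs of t, using the segment [t, 0] when t is negative. *)
Lemma mvt_line0 (V : normedModType R) (F : V -> R) (y v : V) (t : R) :
  (forall s, `|s| <= `|t| -> derivable F (y + s *: v) v) ->
  exists2 s, `|s| <= `|t| & F (y + t *: v) - F y = t * 'D_v F (y + s *: v).
Proof.
move=> dF; have [t0|/ltW t0] := leP 0 t.
  have [s /andP[s0 st]|s /andP[s0 st]] := @mvt_line V F y v 0 t t0.
    by apply: dF; rewrite !ger0_norm.
  rewrite scale0r addr0 subr0 mulrC => FE; exists s => //.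
  by rewrite !ger0_norm.
have [s /andP[ts s0]|s /andP[ts s0]] := @mvt_line V F y v t 0 t0.
  by apply: dF; rewrite !ler0_norm // lerN2.
rewrite scale0r addr0 sub0r mulrN => /eqP; rewrite -eqr_oppLR opprB => /eqP FE.
by exists s; [rewrite !ler0_norm // lerN2|rewrite FE mulrC].
Qed.

End Differentiability.

Section ContinuousPartials.
Variables (R : realType) (m p : nat).
Local Notation V := 'M[R]_(m, p).
Implicit Types (F : V -> R) (x y : V).

Definition unit_mx (e : 'I_m * 'I_p) : V := delta_mx e.1 e.2.

Lemma mx_sum_unit x : x = \sum_(e : 'I_m * 'I_p) x e.1 e.2 *: unit_mx e.
Proof.
rewrite {1}[x]matrix_sum_delta.
by rewrite (pair_bigA _ (fun i j => x i j *: delta_mx i j)).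
Qed.

Lemma norm_entry_le x (e : 'I_m * 'I_p) : `|x e.1 e.2| <= `|x|.
Proof.
rewrite [leRHS]mx_normrE; exact: (le_bigmax _ (fun e => `|x e.1 e.2|)).
Qed.

Lemma norm_unit_mx (e : 'I_m * 'I_p) : `|unit_mx e| <= 1.
Proof.
rewrite [leLHS]mx_normrE; apply/bigmax_leP; split=> // i _; rewrite mxE.
by case: (_ && _); rewrite ?normr1 ?normr0.
Qed.

(** The listed coordinates are changed one at a time, with the mean value theorem at each step. Unit
    matrices have norm at most 1, so every intermediate point stays within d of x. *)
Lemma partials_increment F x (d eps : R) (s : seq ('I_m * 'I_p))
    (c : 'I_m * 'I_p -> R) :
  (forall y, `|y - x| < d -> forall e, derivable F y (unit_mx e) /\
    `|'D_(unit_mx e) F y - 'D_(unit_mx e) F x| <= eps) ->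
  \sum_(e <- s) `|c e| < d ->
  `|F (x + \sum_(e <- s) c e *: unit_mx e) - F x
     - \sum_(e <- s) c e * 'D_(unit_mx e) F x| <= eps * \sum_(e <- s) `|c e|.
Proof.
move=> dF; elim: s => [|e s IH].
  by rewrite !big_nil !addr0 subrr subr0 normr0 mulr0.
rewrite !big_cons => c_lt.
have {}IH := IH (le_lt_trans (ler_wpDl (normr_ge0 _) (lexx _)) c_lt).
set v := \sum_(_ <- s) _ *: _ in IH *.
have v_le : `|v| <= \sum_(e <- s) `|c e|.
  apply: le_trans (ler_norm_sum _ _ _) _; apply: ler_sum => k _.
  by rewrite normrZ ler_piMr // norm_unit_mx.
have near_x t : `|t| <= `|c e| -> `|x + v + t *: unit_mx e - x| < d.
  move=> tc; rewrite addrAC [x + v]addrC addrK; apply: le_lt_trans c_lt.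
  rewrite addrC; apply: le_trans (ler_normD _ _) (lerD _ v_le).
  rewrite normrZ; apply: le_trans tc.
  by rewrite ler_piMr // norm_unit_mx.
have [t tc FE] : exists2 t, `|t| <= `|c e| &
    F (x + v + c e *: unit_mx e) - F (x + v) =
    c e * 'D_(unit_mx e) F (x + v + t *: unit_mx e).
  by apply: mvt_line0 => t tc; apply: (dF _ (near_x _ tc) e).1.
have := (dF _ (near_x _ tc) e).2.
move: FE; rewrite [c e *: _ + v]addrC addrA.
set F1 := F (_ + c e *: _); set D1 := 'D__ F (_ + t *: _); set D0 := 'D__ F x.
set S := \sum_(_ <- s) _ * _ in IH *; set T := \sum_(_ <- s) _ in IH *.
move=> FE D_le; rewrite mulrDr.
(* The error of the new coordinate splits off from the error bounded by the induction hypothesis. *)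
have -> : F1 - F x - (c e * D0 + S) = c e * (D1 - D0) + (F (x + v) - F x - S).
  by rewrite mulrBr -FE; ring.
apply: le_trans (ler_normD _ _) (lerD _ IH).
by rewrite normrM mulrC ler_wpM2r.
Qed.

(** With g the gradient, this is the candidate for the differential. *)
Definition lincomb (g : 'I_m * 'I_p -> R) x : R := \sum_e x e.1 e.2 * g e.

Fact lincomb_linear g : linear (lincomb g).
Proof.
move=> r x y; rewrite /lincomb scaler_sumr -big_split /=.
by apply: eq_bigr => e _; rewrite !mxE mulrDl -mulrA.
Qed.

HB.instance Definition _ g := GRing.isLinear.Build R V R _ (lincomb g)
  (lincomb_linear g).

Lemma lincomb_continuous g : continuous (lincomb g).
Proof.
move=> x; have -> : lincomb g = \sum_e (fun x => x e.1 e.2 * g e).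
  by rewrite fct_sumE.
elim/big_ind: _ => [|f h cf ch|e _]; first exact: cst_continuous.
  exact: continuousD.
by apply: continuousM; [apply: coord_continuous|apply: cst_continuous].
Qed.

Theorem differentiable_of_partials F x :
  (\forall y \near x, forall e, derivable F y (unit_mx e)) ->
  (forall e, {for x, continuous ('D_(unit_mx e) F)}) ->
  differentiable F x.
Proof.
move=> dF cF.
apply: (@differentiable_of_littleo R V R F
  (lincomb (fun e => 'D_(unit_mx e) F x))); first exact: lincomb_continuous.
(* N bounds the sum of the absolute entries by the sup norm; the added 1 keeps it positive for empty
   matrices. *)
move=> eps eps0; pose N : R := #|{: 'I_m * 'I_p}|%:R + 1.
have N0 : 0 < N by rewrite ltr_wpDl.
have /nbhs_ballP [d /= d0 dP] : \forall y \near x, forall e,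
    derivable F y (unit_mx e) /\
    `|'D_(unit_mx e) F y - 'D_(unit_mx e) F x| <= eps / N.
  pose close e y := `|'D_(unit_mx e) F y - 'D_(unit_mx e) F x| <= eps / N.
  have /(filter_forall _) cP e : \forall y \near x, close e y.
    have /cvgrPdist_le/(_ _ (divr_gt0 eps0 N0)) := cF e.
    by apply: filterS => y; rewrite distrC.
  by apply: filterS2 dF cP => y dFy cFy e; split; [apply: dFy|apply: cFy].
have sum_le (h : V) : \sum_e `|h e.1 e.2| <= N * `|h|.
  apply: (@le_trans _ _ (\sum_(e : 'I_m * 'I_p) `|h|)).
    by apply: ler_sum => e _; apply: norm_entry_le.
  by rewrite sumr_const -mulr_natl ler_wpM2r // lerDl.
near=> h.
have hd : \sum_e `|h e.1 e.2| < d.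
  apply: le_lt_trans (sum_le h) _; rewrite mulrC -ltr_pdivlMr //.
  near: h. exact: (@nbhs0_lt R V (d / N) (divr_gt0 d0 N0)).
have := @partials_increment F x d (eps / N) _ (fun e => h e.1 e.2) _ hd.
rewrite -mx_sum_unit [x + h]addrC => /(_ _)/le_trans; apply.
  by move=> y yx; apply: dP; rewrite /= -ball_normE /= distrC.
by rewrite -mulrA (ler_pM2l eps0) ler_pdivrMl.
Unshelve. all: by end_near. Qed.

End ContinuousPartials.

Arguments unit_mx {R m p}.

(** * Twice differentiable functions *)

Section TwiceDifferentiable.
Variables (R : realType) (m p : nat).
Local Notation V := 'M[R]_(m, p).
Implicit Types (F G : V -> R) (x y v : V).

(** A pointwise consequence of being C^2 near x, stable under algebra and composition.
    Differentiability near x makes the formulas for first derivatives valid on a neighbourhood, so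
    that they can be differentiated again. *)
Definition twice_differentiable F x :=
  (\forall y \near x, differentiable F y) /\
  forall v, differentiable ('D_v F) x.

Lemma twice_differentiable1 F x :
  twice_differentiable F x -> differentiable F x.
Proof. by case=> /nbhs_singleton. Qed.

Lemma derive_sum_unit F x v : differentiable F x ->
  'D_v F x = \sum_e v e.1 e.2 * 'D_(unit_mx e) F x.
Proof.
move=> dF; rewrite deriveE // {1}[v]mx_sum_unit linear_sum.
by apply: eq_bigr => e _; rewrite linearZ /= deriveE.
Qed.

Lemma differentiable_bigsum (I : Type) (r : seq I) (f : I -> V -> R) x :
  (forall i, differentiable (f i) x) ->
  differentiable (fun y => \sum_(i <- r) f i y) x.
Proof.
move=> df; rewrite -fct_sumE; elim/big_ind: _ => [|g h dg dh|i _].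
- exact: differentiable_cst.
- exact: differentiableD.
- exact: df.
Qed.

Lemma twice_differentiable_partials F x :
  (\forall y \near x, differentiable F y) ->
  (forall e, differentiable ('D_(unit_mx e) F) x) -> twice_differentiable F x.
Proof.
move=> dF ddF; split=> // v.
apply: (@near_eq_differentiable _ _ _
  (fun y => \sum_e v e.1 e.2 * 'D_(unit_mx e) F y)).
  by apply: filterS dF => y dFy; rewrite derive_sum_unit.
by apply: differentiable_bigsum => e; apply: differentiableM.
Qed.

Lemma twice_differentiable_cst (c : R) x : twice_differentiable (fun=> c) x.
Proof.
split=> [|v]; first by near=> y; apply: differentiable_cst.
rewrite (_ : 'D_v _ = cst 0); first exact: differentiable_cst.
by apply/funext => y; rewrite derive_cst.
Unshelve. all: by end_near. Qed.

Lemma twice_differentiable_coord i j x :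
  twice_differentiable (fun y : V => y i j) x.
Proof.
split=> [|v]; first by near=> y; apply: differentiable_coord.
rewrite (_ : 'D_v _ = cst (v i j)); first exact: differentiable_cst.
apply/funext => y; rewrite deriveE; last exact: differentiable_coord.
(* The coordinate is packed as a linear map, which is its own differential. *)
pose c : V -> R := fun y => y i j.
have c_lin : linear c by move=> r u w; rewrite /c !mxE.
pose C := GRing.isLinear.Build R V R _ c c_lin.
pose cL : {linear V -> R} := HB.pack c C.
have -> : (fun y : V => y i j) = cL by [].
by rewrite diff_lin //; apply: coord_continuous.
Unshelve. all: by end_near. Qed.

Lemma twice_differentiableD F G x :
  twice_differentiable F x -> twice_differentiable G x ->
  twice_differentiable (fun y => F y + G y) x.
Proof.
move=> [dF ddF] [dG ddG]; split=> [|v].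
  by apply: filterS2 dF dG => y dFy dGy; apply: differentiableD.
apply: (@near_eq_differentiable _ _ _ ('D_v F + 'D_v G)); last first.
  exact: differentiableD.
apply: filterS2 dF dG => y dFy dGy.
by rewrite deriveD //; apply: diff_derivable.
Qed.

Lemma twice_differentiableM F G x :
  twice_differentiable F x -> twice_differentiable G x ->
  twice_differentiable (fun y => F y * G y) x.
Proof.
move=> tF tG; have [dF ddF] := tF; have [dG ddG] := tG; split=> [|v].
  by apply: filterS2 dF dG => y dFy dGy; apply: differentiableM.
apply: (@near_eq_differentiable _ _ _ (F * 'D_v G + G * 'D_v F)); last first.
  apply: differentiableD; apply: differentiableM => //;
    exact: twice_differentiable1.
apply: filterS2 dF dG => y dFy dGy.
by rewrite (@deriveM _ _ F G) //; apply: diff_derivable.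
Qed.

Lemma twice_differentiableN F x :
  twice_differentiable F x -> twice_differentiable (fun y => - F y) x.
Proof.
move=> tF; rewrite (_ : (fun y => - F y) = (fun y => - 1 * F y)).
  by apply: twice_differentiableM => //; apply: twice_differentiable_cst.
by apply/funext => y; rewrite mulN1r.
Qed.

Lemma twice_differentiableV F x : F x != 0 ->
  twice_differentiable F x -> twice_differentiable (fun y => (F y)^-1) x.
Proof.
move=> Fx0 tF; have [dF ddF] := tF; have dFx := twice_differentiable1 tF.
have F0 : \forall y \near x, F y != 0.
  exact: (cvgr_neq0 _ (differentiable_continuous dFx) Fx0).
split=> [|v].
  by apply: filterS2 dF F0 => y dFy Fy0; apply: differentiableV.
apply: (@near_eq_differentiable _ _ _
  (fun y => (- (F y)^-1) * (F y)^-1 * 'D_v F y)); last first.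
  apply: differentiableM => //; apply: differentiableM.
    by apply: differentiableN; apply: differentiableV.
  exact: differentiableV.
apply: filterS2 dF F0 => y dFy Fy0.
rewrite deriveV //; last exact: diff_derivable.
by rewrite expr2 invfM mulNr.
Qed.

Lemma differentiable_mx (q l : nat) (P : V -> 'M[R]_(q, l)) x :
  (forall i j, differentiable (fun y => P y i j) x) -> differentiable P x.
Proof.
move=> dP; have -> : P = \sum_e (fun y => P y e.1 e.2 *: unit_mx e).
  by rewrite fct_sumE; apply/funext => y; apply: mx_sum_unit.
elim/big_ind: _ => [|g h dg dh|e _].
- exact: differentiable_cst.
- exact: differentiableD.
- exact: differentiableZl.
Qed.

Lemma derive_mx_coord (q l : nat) (P : V -> 'M[R]_(q, l)) x v i j :
  differentiable P x -> ('D_v P x) i j = 'D_v (fun y => P y i j) x.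
Proof.
by move=> dP; rewrite derive_mx ?mxE //; apply: diff_derivable.
Qed.

End TwiceDifferentiable.

Lemma derive_compE (R : realType) (U V W : normedModType R) (P : U -> V)
    (F : V -> W) x v : differentiable P x -> differentiable F (P x) ->
  'D_v (F \o P) x = 'D_('D_v P x) F (P x).
Proof.
move=> dP dF; rewrite deriveE; last exact: differentiable_comp.
by rewrite diff_comp //= -(deriveE _ dF) -(deriveE _ dP).
Qed.

(** Near x the chain rule writes the derivative as a finite sum of products of derivatives of
    entries of P and partials of F along P, each differentiable at x. *)
Lemma twice_differentiable_comp (R : realType) (m p q l : nat)
    (F : 'M[R]_(q, l) -> R) (P : 'M[R]_(m, p) -> 'M[R]_(q, l)) x :
  twice_differentiable F (P x) ->
  (forall i j, twice_differentiable (fun y => P y i j) x) ->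
  twice_differentiable (F \o P) x.
Proof.
move=> [dF ddF] tP.
have dP : \forall y \near x, differentiable P y.
  have dPe (e : 'I_q * 'I_l) :
      \forall y \near x, differentiable (fun y => P y e.1 e.2) y.
    by have [] := tP e.1 e.2.
  apply: filterS (filter_forall _ dPe) => y dPy.
  by apply: differentiable_mx => i j; apply: (dPy (i, j)).
have dPx := nbhs_singleton dP.
have dFP : \forall y \near x, differentiable F (P y).
  have cP : P @ x --> P x := differentiable_continuous dPx.
  exact: (cP _ dF).
have dFPy : \forall y \near x, differentiable (F \o P) y.
  by apply: filterS2 dP dFP => y dPy dFy; apply: differentiable_comp.
split=> // v; apply: (@near_eq_differentiable _ _ _ (fun y =>
    \sum_e 'D_v (fun z => P z e.1 e.2) y * 'D_(unit_mx e) F (P y))).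
  apply: filterS2 dP dFP => y dPy dFy.
  rewrite (derive_compE v dPy dFy) (derive_sum_unit _ dFy).
  by apply: eq_bigr => e _; rewrite derive_mx_coord.
apply: differentiable_bigsum => e; apply: differentiableM.
  exact: (tP e.1 e.2).2.
exact: (differentiable_comp dPx (ddF (unit_mx e))).
Qed.

(** * Invariance of the Laplacian *)

Section LaplacianIsometry.
Variables (R : realType) (m p : nat).
Local Notation V := 'M[R]_(m, p).
Implicit Types (F G : V -> R) (x y v : V).

Lemma linear_mx_continuous (L : {linear V -> V}) : continuous L.
Proof.
move=> x; apply: differentiable_continuous; apply: differentiable_mx => i j.
have -> : (fun y => L y i j) = lincomb (fun e => L (unit_mx e) i j).
  apply/funext => y; rewrite {1}[y]mx_sum_unit linear_sum summxE.
  by apply: eq_bigr => e _; rewrite linearZ mxE.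
exact/linear_differentiable/lincomb_continuous.
Qed.

Definition mx_laplacian F x : R :=
  \sum_(e : 'I_m * 'I_p) 'D_(unit_mx e) ('D_(unit_mx e) F) x.

Lemma near_eq_mx_laplacian F G x : (\near x, F x = G x) ->
  mx_laplacian F x = mx_laplacian G x.
Proof.
move=> FG; apply: eq_bigr => e _; apply: near_eq_derive.
(* At points near x the two functions still agree on a neighbourhood, so their first derivatives
   agree near x. *)
by apply: filterS (near_join FG) => y; apply: near_eq_derive.
Qed.

Lemma derive_bigsum (I : Type) (r : seq I) (f : I -> V -> R) x v :
  (forall i, differentiable (f i) x) ->
  'D_v (fun y => \sum_(i <- r) f i y) x = \sum_(i <- r) 'D_v (f i) x.
Proof.
move=> df; elim: r => [|i r IH].
  rewrite big_nil (_ : (fun _ => _) = cst 0) ?derive_cst //.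
  by apply/funext => y; rewrite big_nil.
rewrite (_ : (fun _ => _) = f i + (fun y => \sum_(k <- r) f k y)).
  rewrite big_cons -IH deriveD //; apply: diff_derivable => //.
  exact: differentiable_bigsum.
by apply/funext => y; rewrite big_cons.
Qed.

Lemma sum_orthonormal (I : finType) (t D : I -> I -> R) :
  (forall k l, \sum_e t k e * t l e = (k == l)%:R) ->
  \sum_e \sum_k \sum_l t k e * t l e * D k l = \sum_k D k k.
Proof.
move=> tt; rewrite exchange_big; apply: eq_bigr => k _; rewrite exchange_big /=.
rewrite (bigD1 k) //= -mulr_suml tt eqxx mul1r big1 ?addr0 // => l lk.
by rewrite -mulr_suml tt eq_sym (negbTE lk) mul0r.
Qed.

(** Each pure second derivative of [F \o L] is a quadratic expression in the matrix entries [t] of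
    L; summed over directions, orthonormality of the rows of [t] leaves the trace of the Hessian of
    F. *)
Lemma mx_laplacian_isometry F (L : {linear V -> V}) :
  (forall x, sqnormm (L x) = sqnormm x) -> twice_differentiable F 0 ->
  mx_laplacian (F \o L) 0 = mx_laplacian F 0.
Proof.
move=> isoL [dF ddF]; have cL := @linear_mx_continuous L.
have dL y : differentiable L y by apply: linear_differentiable.
have deriveFL G v y : differentiable G (L y) -> 'D_v (G \o L) y =
    \sum_k L v k.1 k.2 * 'D_(unit_mx k) G (L y).
  move=> dG; rewrite (derive_compE v (dL y) dG) (deriveE _ (dL y)).
  by rewrite (diff_lin _ cL) derive_sum_unit.
have L0 : L 0 = 0 := linear0 L.
have dFL : nbhs (0 : V) [set y | differentiable F (L y)].
  by have := cL 0; rewrite /continuous_at L0 => cL0; exact: (cL0 _ dF).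
pose t (k e : 'I_m * 'I_p) : R := L (unit_mx e) k.1 k.2.
have dde e : 'D_(unit_mx e) ('D_(unit_mx e) (F \o L)) 0 =
    \sum_k \sum_l t k e * t l e * 'D_(unit_mx l) ('D_(unit_mx k) F) 0.
  (* The first-derivative formula holds near 0, hence may be differentiated there. *)
  rewrite (@near_eq_derive _ _ _ _
    (fun y => \sum_k t k e * ('D_(unit_mx k) F \o L) y)); last first.
    by apply: filterS dFL => y dFy; rewrite deriveFL.
  have dk k : differentiable ('D_(unit_mx k) F \o L) 0.
    by apply: differentiable_comp; rewrite ?L0.
  rewrite derive_bigsum => [|k]; last exact: differentiableZ.
  apply: eq_bigr => k _; rewrite deriveZ; last exact: diff_derivable.
  rewrite deriveFL L0 // scaler_sumr.
  by apply: eq_bigr => l _; rewrite -mulrA.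
transitivity (\sum_e \sum_k \sum_l
    t k e * t l e * 'D_(unit_mx l) ('D_(unit_mx k) F) 0).
  by apply: eq_bigr => e _; exact: dde.
exact: (sum_orthonormal (fun k l => 'D_(unit_mx l) ('D_(unit_mx k) F) 0)
  (isometry_rows isoL)).
Qed.

End LaplacianIsometry.

(** * Smoothness of quaternion-valued maps *)

Section QuaternionCalculus.
Variables (R : realType) (m p : nat).
Local Notation H := (quat R).
Local Notation V := 'M[R]_(m, p).
Implicit Types (P Q : V -> H) (x : V).

Definition quat_smooth P x :=
  [/\ twice_differentiable (fun y => qre (P y)) x,
      twice_differentiable (fun y => qi (P y)) x,
      twice_differentiable (fun y => qj (P y)) x &
      twice_differentiable (fun y => qk (P y)) x].

Ltac smooth := repeat lazymatch goal with
  | |- twice_differentiable (fun=> _ + _) _ => apply: twice_differentiableD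
  | |- twice_differentiable (fun=> - _) _ => apply: twice_differentiableN
  | |- twice_differentiable (fun=> _ * _) _ => apply: twice_differentiableM
  | |- twice_differentiable (fun=> _ ^+ 2) _ => apply: twice_differentiableM
  | |- twice_differentiable _ _ =>
      first [assumption | apply: twice_differentiable_cst]
  end.

Lemma quat_smooth_cst (c : H) x : quat_smooth (fun=> c) x.
Proof. by split; smooth. Qed.

Lemma quat_smoothD P Q x : quat_smooth P x -> quat_smooth Q x ->
  quat_smooth (fun y => P y + Q y) x.
Proof. by move=> [????] [????]; split => /=; smooth. Qed.

Lemma quat_smoothN P x : quat_smooth P x -> quat_smooth (fun y => - P y) x.
Proof. by move=> [????]; split => /=; smooth. Qed.

Lemma quat_smoothM P Q x : quat_smooth P x -> quat_smooth Q x ->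
  quat_smooth (fun y => P y * Q y) x.
Proof. by move=> [????] [????]; split => /=; smooth. Qed.

Lemma quat_smooth_sum (I : Type) (r : seq I) (P : I -> V -> H) x :
  (forall i, quat_smooth (P i) x) ->
  quat_smooth (fun y => \sum_(i <- r) P i y) x.
Proof.
move=> sP; rewrite -fct_sumE; elim/big_ind: _ => [|f g sf sg|i _].
- exact: quat_smooth_cst.
- exact: quat_smoothD.
- exact: sP.
Qed.

(** By definition the inverse is the conjugate times the real reciprocal of the squared norm, so
    only a real inverse is involved. *)
Lemma quat_smoothV P x : P x != 0 -> quat_smooth P x ->
  quat_smooth (fun y => (P y)^-1) x.
Proof.
rewrite -sqnormq_eq0 => Px0 sP; have [????] := sP.
rewrite (_ : (fun y => _) =
  (fun y => qreal (sqnormq (P y))^-1 * conjq (P y))) //.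
apply: quat_smoothM; last by split=> /=; smooth.
split=> /=; try exact: twice_differentiable_cst.
apply: twice_differentiableV => //.
by rewrite /sqnormq; smooth.
Qed.

End QuaternionCalculus.

(** * Calculus on the quaternionic ball *)

Section BallCalculus.
Variables (R : realType) (n : nat).
Local Notation H := (quat R).
Implicit Types (a q : 'cV[H]_n) (x : 'M[R]_(n, 4)).

Lemma sqnormm_continuous m p : continuous (@sqnormm R m p).
Proof.
move=> x; apply: differentiable_continuous.
apply: differentiable_bigsum => e; rewrite (_ : (fun _ => _) =
  (fun y : 'M[R]_(m, p) => y e.1 e.2) * (fun y => y e.1 e.2)).
  by apply: differentiableM; apply: differentiable_coord.
by apply/funext => y; rewrite expr2.
Qed.

Lemma qball_ofrealE x : qball (ofreal x) = (sqnormm x < 1) :> Prop.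
Proof. by rewrite -[x in RHS]ofrealK sqnormm_toreal. Qed.

Lemma near_qball x : qball (ofreal x) -> \forall y \near x, qball (ofreal y).
Proof.
rewrite qball_ofrealE => x1; near=> y; rewrite qball_ofrealE; near: y.
have /cvgr_lt := sqnormm_continuous (x := x); exact.
Unshelve. all: by end_near. Qed.

(** [differentiable_of_partials] is applied to the function and then to its partials; openness of
    the ball supplies the neighbourhoods. *)
Lemma C2_ball_twice_differentiable (f : 'cV[H]_n -> R) a :
  C2_ball f -> qball a -> twice_differentiable (f \o @ofreal R n) (toreal a).
Proof.
move=> C2f a1; set F := f \o _.
have dF y : qball (ofreal y) -> differentiable F y.
  move=> y1; apply: differentiable_of_partials.
    apply: filterS (near_qball y1) => z z1 e.
    by have [_ dF _] := C2f z z1; have [] := dF e.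
  by move=> e; have [_ dF _] := C2f y y1; have [] := dF e.
have a1' : qball (ofreal (toreal a)) by rewrite torealK.
apply: twice_differentiable_partials.
  by apply: filterS (near_qball a1') => y; apply: dF.
move=> e; apply: differentiable_of_partials.
  apply: filterS (near_qball a1') => z z1 e'.
  by have [_ _ ddF] := C2f z z1; have [] := ddF e e'.
by move=> e'; have [_ _ ddF] := C2f _ a1'; have [] := ddF e e'.
Qed.

Lemma phiE a q i : phi a q i 0 = (a i 0 - \sum_k A_ a i k * q k 0)
  * (1 - \sum_k adjmx a 0 k * q k 0)^-1.
Proof. by rewrite /phi mxE big_ord1 !mxE eqxx mulr1n. Qed.

Lemma quat_smooth_ofreal (k : 'I_n) x :
  quat_smooth (fun y : 'M[R]_(n, 4) => ofreal y k 0) x.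
Proof.
by split; under eq_fun do rewrite mxE /=; apply: twice_differentiable_coord.
Qed.

(** The denominator 1 - a^* q equals 1 at the origin, so its inverse is smooth there. *)
Lemma twice_differentiable_phi a (i : 'I_n) (j : 'I_4) :
  twice_differentiable (fun y => toreal (phi a (ofreal y)) i j) 0.
Proof.
have sum_smooth (c : 'I_n -> H) :
    quat_smooth (fun y => \sum_k c k * ofreal y k 0) 0.
  apply: quat_smooth_sum => k; apply: quat_smoothM.
    exact: quat_smooth_cst.
  exact: quat_smooth_ofreal.
have [] : quat_smooth (fun y => phi a (ofreal y) i 0) 0.
  under eq_fun do rewrite phiE.
  apply: quat_smoothM.
    apply: quat_smoothD; first exact: quat_smooth_cst.
    exact/quat_smoothN/sum_smooth.
  apply: quat_smoothV; last first.
    apply: quat_smoothD; first exact: quat_smooth_cst.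
    exact/quat_smoothN/sum_smooth.
  rewrite big1 ?subr0 ?oner_neq0 // => k _.
  suff -> : ofreal (0 : 'M[R]_(n, 4)) k 0 = 0 by rewrite mulr0.
  by rewrite !mxE.
move=> s0 s1 s2 s3.
by case: j => [[|[|[|[|//]]]] lt_j4]; under eq_fun do rewrite mxE /=.
Qed.

Lemma toreal0 : toreal (0 : 'cV[H]_n) = 0.
Proof.
apply: (can_inj (@ofrealK R n)); rewrite torealK.
by apply/matrixP => i j; rewrite !mxE.
Qed.

Lemma invariant_laplacianE (h : 'cV[H]_n -> R) a :
  invariant_laplacian h a = mx_laplacian (h \o phi a \o @ofreal R n) 0.
Proof.
by rewrite /invariant_laplacian /euclidean_laplacian toreal0.
Qed.

End BallCalculus.

Theorem proposition3p1 (R : realType) (n : nat) (n_ge1 : (1 <= n)%N)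
    (psi : 'cV[quat R]_n -> 'cV[quat R]_n) (f : 'cV[quat R]_n -> R)
    (a : 'cV[quat R]_n) :
  QM_transformation psi -> C2_ball f -> qball a ->
  invariant_laplacian (f \o psi) a = invariant_laplacian f (psi a).
Proof.
move=> QMpsi C2f a1.
have [pa1 [V [c [isoV psiE]]]] := QM_transformation_phi QMpsi a1.
rewrite (invariant_laplacianE (f \o psi)) (invariant_laplacianE f).
pose g : 'M[R]_(n, 4) -> R := f \o phi (psi a) \o @ofreal R n.
have ball0 : qball (ofreal (0 : 'M[R]_(n, 4))).
  by rewrite -toreal0 torealK; apply: qball0.
(* The normal form of psi holds on the ball only, which is a neighbourhood of 0 and so determines
   the Laplacian at 0. *)
transitivity (mx_laplacian (g \o real_mul V c) 0).
  apply: near_eq_mx_laplacian; apply: filterS (near_qball ball0) => y y1.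
  by rewrite /g /= /real_mul torealK psiE.
apply: mx_laplacian_isometry => [x|].
  by rewrite sqnormm_toreal isoV -sqnormm_toreal ofrealK.
(* Inserting [ofreal \o toreal] makes g a composite of maps between real matrix spaces. *)
have -> : g = (f \o @ofreal R n) \o (@toreal R n \o phi (psi a) \o @ofreal R n).
  by apply/funext => y; rewrite /g /= torealK.
apply: twice_differentiable_comp => [|i j]; last exact: twice_differentiable_phi.
rewrite /= -toreal0 torealK phi_0; exact: C2_ball_twice_differentiable.
Qed.
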